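(* Let $\alpha\in\mathbb{Q}\setminus\mathbb{Z}$ and let $k>1$ be an integer. Then $$\sum_{n=-\infty}^{+\infty}\frac{1}{(n+\alpha)^k}$$ is either null or a transcendental number. It is null if and only if $k$ is odd and $\alpha$ is a half-integer.
   Context: A half-integer is a number of the form $m+\frac12$ with $m\in\mathbb{Z}$. ''Null'' means that the sum equals $0$. The bilateral series is over all $n\in\mathbb{Z}$ and converges absolutely. *)

(* Defs.v *)
From mathcomp Require Import all_boot all_order all_algebra.
From mathcomp Require Import all_classical all_reals all_analysis.

Set Implicit Arguments.
Unset Strict Implicit.
Unset Printing Implicit Defensive.

Import Order.TTheory GRing.Theory Num.Theory.
Import numFieldNormedType.Exports.

Local Open Scope ring_scope.

Definition transcendental (R : realType) (x : R) : Prop :=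
  ~ algebraicOver (ratr : rat -> R) x.

Definition half_integer (a : rat) : Prop :=
  exists m : int, a = m%:~R + 1 / 2%:R.

Definition bilateral_term (R : realType) (alpha : rat) (k : nat) (n : int) : R :=
  1 / (n%:~R + ratr alpha) ^+ k.

Definition absolutely_convergent (R : realType) (f : int -> R) : Prop :=
  summable [set: int]%classic (fun n => (f n)%:E).

(* The indices n >= 0 and n <= -1 are summed separately. Each [limn] is
   meaningful only if its series converges, e.g. if [f] is
   [absolutely_convergent]. *)
Definition bilateral_sum (R : realType) (f : int -> R) : R :=
  limn (series (fun n : nat => f n%:Z)) +
  limn (series (fun n : nat => f (- (n.+1)%:Z))).

(* Main.v *)
Require Import Defs.
From mathcomp Require Import all_boot all_order all_algebra.
From mathcomp Require Import all_classical all_reals all_analysis.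
From mathcomp Require Import perm complex ring lra zify.
From mathcomp Require Import -(notations) mpoly.

Set Implicit Arguments.
Unset Strict Implicit.
Unset Printing Implicit Defensive.

Import Order.TTheory GRing.Theory Num.Theory.
Import numFieldNormedType.Exports.

Local Open Scope ring_scope.

(** For k > 1 write zeta_k(x) for the Hurwitz zeta function, the sum of
(n + x)^-k over n >= 0. Translating alpha by an integer only re-indexes the
bilateral series, so alpha may be replaced by its fractional part x in ]0, 1[;
the nonnegative and the negative indices then contribute
zeta_k(x) + (-1)^k zeta_k(1 - x) ([periodic_zeta]).

Zeros ([periodic_zeta_eq0]). Since zeta_k is positive, the value is positive
when k is even. When k is odd it is zeta_k(x) - zeta_k(1 - x), and zeta_k is
strictly decreasing, so it vanishes exactly when x = 1 - x.

Transcendence ([periodic_zeta_transcendental]). The value is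
pi^k P_k(cot (pi x)) for a polynomial P_k with rational coefficients
([periodic_zeta_cot]). For k = 2 it is pi^2 / sin^2 (pi x): the difference of
the two sides is bounded on ]0, 1[ and satisfies
g(x / 2) + g((x + 1) / 2) = 4 g(x), which forces g = 0 (Herglotz). Termwise
differentiation then leads from k to k + 1. As x is rational, exp (i pi x) is a
root of unity and cot (pi x) is algebraic. A nonzero algebraic value would
therefore make pi^k algebraic, hence pi, hence i pi, against the next fact.

No algebraic z has exp z = -1 ([cexp_eqN1_transcendental]). This is Lindemann's
theorem for pi, by the method of Hermite and Niven. Let theta_1, ..., theta_n be
the roots of an integer polynomial that vanishes at z, and l its leading
coefficient. The vanishing product of the 1 + exp theta_j expands into the sum
of exp x_S over the subsets S, where x_S is the sum of the theta_j for j in S.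
For a polynomial G, the polynomial H(y), the sum of the l^i G^(i)(y), satisfies
H(l x) ~ H(0) exp x with a small error ([hermite_remainder]); so the sum of all
H(l x_S) is small. Take G = X^p Q^(p+1), where Q is an integer polynomial with
Q(0) <> 0 that vanishes at every nonzero l x_S. Then the same sum is p! times an
integer ([hermite_sum_integer]), because symmetric functions of the integral
numbers l theta_j are integers ([integer_subset_sums]); and this integer is not
divisible by p + 1 when p + 1 is a large prime. It is thus at least p! in
absolute value, while the error grows only geometrically in p. *)

(** * Symmetric functions of the roots of a monic integer polynomial *)

Definition integer (C : nzRingType) (x : C) : Prop := exists z : int, x = z%:~R.

Lemma integer_intr (C : nzRingType) (z : int) : integer (z%:~R : C).
Proof. by exists z. Qed.

Lemma integerD (C : nzRingType) (x y : C) : integer x -> integer y -> integer (x + y).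
Proof. by move=> [a ->] [b ->]; exists (a + b); rewrite rmorphD. Qed.

Lemma integerM (C : nzRingType) (x y : C) : integer x -> integer y -> integer (x * y).
Proof. by move=> [a ->] [b ->]; exists (a * b); rewrite rmorphM. Qed.

Lemma integer_sum (C : nzRingType) (I : Type) (r : seq I) (P : pred I) (F : I -> C) :
  (forall i, P i -> integer (F i)) -> integer (\sum_(i <- r | P i) F i).
Proof.
by move=> h; elim/big_ind: _ => //; [exists 0 | exact: integerD].
Qed.

(** The polynomial G is an integer polynomial in the elementary symmetric ones,
and these take the coefficients of the given product, up to sign, as values. *)
Lemma integer_symmetric (C : idomainType) (n : nat) (c : n.-tuple C) (G : mpoly n int) :
  injective (intr : int -> C) ->
  (forall i, integer (\prod_(x <- c) ('X - x%:P))`_i) ->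
  G \is symmetric -> integer (meval (tnth c) (map_mpoly intr G)).
Proof.
move=> inj hc /sym_fundamental[u [<- _]].
rewrite map_mpoly_comp // comp_mpoly_meval.
rewrite mevalE; apply: integer_sum => m _.
rewrite mcoeff_map_mpoly; apply: integerM; first exact: integer_intr.
apply: (big_ind (@integer C)) => [||i _]; first by exists 1.
  exact: integerM.
rewrite tnth_map tnth_mktuple.
have -> : map_mpoly intr (mesym n int i.+1) = mesym n C i.+1.
  rewrite !mesymE rmorph_sum /=; apply: eq_bigr => h _; exact: map_mpolyX.
have : integer (meval (tnth c) (mesym n C i.+1)).
  have := mroots_coeff c (lift ord0 i) => /(congr1 ( *%R ((-1) ^+ (lift ord0 i)))).
  rewrite mulrA -exprMn mulrNN mulr1 expr1n mul1r => <-.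
  apply: integerM => //; exists ((-1) ^+ lift ord0 i); by rewrite rmorphXn rmorphN1.
elim: (m i) => [|k IH] h; first by exists 1.
by rewrite exprS; apply: integerM => //; exact: IH.
Qed.

(** Permuting the variables permutes the subsets, so that each power sum of the
subset sums is symmetric. *)
Lemma integer_subset_sums (C : idomainType) (n : nat) (c : n.-tuple C) (G : {poly int}) :
  injective (intr : int -> C) ->
  (forall i, integer (\prod_(x <- c) ('X - x%:P))`_i) ->
  integer (\sum_(S : {set 'I_n}) (map_poly intr G).[\sum_(i in S) tnth c i]).
Proof.
move=> inj hc.
have powers m : integer (\sum_(S : {set 'I_n}) (\sum_(i in S) tnth c i) ^+ m).
  pose H : mpoly n int :=
    \sum_(S : {set 'I_n}) (\sum_(i in S) mpolyX int (mnm1 i)) ^+ m.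
  have symH : H \is symmetric.
    apply/issymP => s; rewrite /H rmorph_sum /=.
    rewrite [RHS](reindex_inj (imset_inj (@perm_inj _ s))) /=.
    apply: eq_bigr => S _; rewrite rmorphXn /= rmorph_sum /=; congr (_ ^+ _).
    rewrite big_imset /=; last by move=> x y _ _; exact: perm_inj.
    apply: eq_bigr => i _; rewrite msymX; congr (mpolyX _ _).
    apply/mnmP => j; rewrite mnmE !mnm1E.
    by rewrite -(inj_eq (@perm_inj _ s)) permKV.
  have := integer_symmetric inj hc symH.
  rewrite /H (rmorph_sum (map_mpoly intr)) (rmorph_sum (meval (tnth c))).
  congr integer; apply: eq_bigr => S _.
  rewrite !rmorphXn (rmorph_sum (map_mpoly intr)) (rmorph_sum (meval (tnth c))).
  congr (_ ^+ _); apply: eq_bigr => i _.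
  exact: (etrans (congr1 (meval (tnth c)) (map_mpolyX _ _)) (mevalXU _ _)).
have -> : \sum_(S : {set 'I_n}) (map_poly intr G).[\sum_(i in S) tnth c i] =
   \sum_(m < size G) (G`_m)%:~R * \sum_(S : {set 'I_n}) (\sum_(i in S) tnth c i) ^+ m.
  under eq_bigr => S _ do rewrite horner_coef size_map_inj_poly //.
  rewrite exchange_big; apply: eq_bigr => m _; rewrite mulr_sumr.
  by apply: eq_bigr => S _; rewrite coef_map_id0.
by apply: integer_sum => m _; apply: integerM => //; exact: integer_intr.
Qed.

(** * The complex exponential *)

Lemma ge0_of_derive_ge0 (R : realType) (D d : R -> R) (b : R) :
  (forall t : R, is_derive t 1 D (d t)) -> (forall t, 0 <= t <= b -> 0 <= d t) ->
  0 <= D 0 -> 0 <= b -> 0 <= D b.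
Proof.
move=> dD d0 D0 b0.
have [|c] := @MVT_segment R D d 0 b b0 (fun x _ => dD x).
  by apply: derivable_within_continuous => x _; apply: ex_derive.
rewrite in_itv /= => c0b /eqP; rewrite subr_eq => /eqP ->.
by apply: addr_ge0 => //; apply: mulr_ge0; [exact: d0 | rewrite subr0].
Qed.

Section ComplexExponential.
Local Open Scope complex_scope.
Local Notation Re := complex.Re.
Local Notation Im := complex.Im.
Variable R : realType.
Implicit Types (z w : R[i]) (t : R).

Definition cexp z : R[i] :=
  (expR (Re z) * cos (Im z)) +i* (expR (Re z) * sin (Im z)).

Lemma cexp0 : cexp 0 = 1.
Proof. by rewrite /cexp /= expR0 cos0 sin0 !mul1r. Qed.

Lemma cexpD z w : cexp (z + w) = cexp z * cexp w.
Proof.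
case: z w => [a b] [c d]; rewrite /cexp /= expRD cosD sinD.
by simpc; congr (_ +i* _); ring.
Qed.

Lemma cexp_sum (I : Type) (r : seq I) (P : pred I) (F : I -> R[i]) :
  cexp (\sum_(i <- r | P i) F i) = \prod_(i <- r | P i) cexp (F i).
Proof. by rewrite (big_morph _ cexpD cexp0). Qed.

Lemma cexp_ipi : cexp (0 +i* pi) = -1.
Proof.
by apply/eqP; rewrite eq_complex /cexp /= expR0 cospi sinpi mul1r mulr0 oppr0 !eqxx.
Qed.

Definition taylor_poly (c : nat -> R) m : {poly R} := \poly_(i < m) (c i / i`!%:R).

Lemma deriv_taylor_poly c m :
  (taylor_poly c m.+1)^`() = taylor_poly (fun i => c i.+1) m.
Proof.
apply/polyP => i; rewrite coef_deriv !coef_poly ltnS; case: ifP => _; last by rewrite mul0rn.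
by rewrite -[LHS]mulr_natr factS natrM invfM mulrC mulrCA mulVKf.
Qed.

(** A real-valued form of cexp (t z), to which one-variable calculus applies.
The factor w selects a direction; differentiating in t multiplies it by z. *)
Definition Re_cexp w z t : R :=
  expR (t * Re z) * (Re w * cos (t * Im z) - Im w * sin (t * Im z)).

Lemma Re_cexpE w z t : Re_cexp w z t = Re (w * cexp (t%:C * z)).
Proof.
case: w z => [w1 w2] [a b]; rewrite /Re_cexp /cexp /=.
by rewrite !mul0r subr0 addr0; ring.
Qed.

Lemma is_derive_Re_cexp w z t : is_derive t 1 (Re_cexp w z) (Re_cexp (w * z) z t).
Proof.
case: w z => [w1 w2] [a b].
have lin (x : R) : is_derive t 1 (fun s : R => s * x) x.
  by apply: is_derive_eq; rewrite scaler0 add0r -[RHS]mulr1.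
have E := @is_derive1_comp R expR (fun s => s * a) t _ _ (is_derive_expR _) (lin a).
have C := @is_derive1_comp R cos (fun s => s * b) t _ _ (is_derive_cos _) (lin b).
have S := @is_derive1_comp R sin (fun s => s * b) t _ _ (is_derive_sin _) (lin b).
rewrite (_ : Re_cexp _ _ = (expR \o (fun s => s * a)) *
  ((cst w1 * (cos \o (fun s => s * b))) - (cst w2 * (sin \o (fun s => s * b))))); last first.
  by apply/funext.
apply: is_derive_eq.
by rewrite /Re_cexp ?fctE /= /GRing.scale /=; ring.
Qed.

(** Induction on m: the derivative in t of the remainder of order m + 1 in the
direction w is the remainder of order m in the direction w z, which is why the
bound must be proved for all w at once. *)
Lemma Re_cexp_remainder m w z (W r t : R) : `|w| = W%:C -> `|z| = r%:C -> 0 <= t ->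
  Re_cexp w z t - (taylor_poly (fun i => Re (w * z ^+ i)) m).[t] <=
  W * ((t * r) ^+ m / m`!%:R * expR (t * r)).
Proof.
move=> + zr; have r0 : 0 <= r by rewrite -ler0c -zr.
have zre : Re z <= r.
  by rewrite -lecR -zr (le_trans _ (normc_ge_Re _))// lecR ler_norm.
elim: m w W t => [|m IH] w W t wW t0.
  rewrite /taylor_poly poly_def big_ord0 horner0 subr0 expr0 fact0 invr1 mulr1 mul1r Re_cexpE.
  have W0 : 0 <= W by rewrite -ler0c -wW.
  rewrite -lecR (le_trans (_ : _ <= `|w * cexp (t%:C * z)|))//.
    by rewrite (le_trans _ (normc_ge_Re _))// lecR ler_norm.
  rewrite normrM wW rmorphM /= ler_wpM2l ?ler0c//.
  rewrite normc_def lecR /cexp /= !exprMn -mulrDr cos2Dsin2 mulr1 sqrtr_sqr.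
  rewrite ger0_norm ?expR_ge0 // ler_expR.
  case: (z) zre => a b /= ar; rewrite mul0r subr0; exact: ler_wpM2l.
rewrite -subr_ge0.
(* D is the bound minus the remainder, d its derivative; D vanishes at 0. *)
pose D (t : R) := W * ((t * r) ^+ m.+1 / (m.+1)`!%:R * expR (t * r)) -
   (Re_cexp w z t - (taylor_poly (fun i => Re (w * z ^+ i)) m.+1).[t]).
pose d (t : R) := W * (r * (t * r) ^+ m / m`!%:R * expR (t * r) +
    r * ((t * r) ^+ m.+1 / (m.+1)`!%:R * expR (t * r))) -
   (Re_cexp (w * z) z t - (taylor_poly (fun i => Re (w * z ^+ i.+1)) m).[t]).
have W0 : 0 <= W by rewrite -ler0c -wW.
apply: (@ge0_of_derive_ge0 R D d) => // {t0}.
- move=> {}t; rewrite /D /d.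
  have lin (x : R) : is_derive t 1 (fun s : R => s * x) x.
    by apply: is_derive_eq; rewrite scaler0 add0r -[RHS]mulr1.
  have E := @is_derive1_comp R expR (fun s => s * r) t _ _ (is_derive_expR _) (lin r).
  have L := lin r; have G := is_derive_Re_cexp w z t.
  rewrite (_ : (fun _ => _) =
    cst W * (((fun s : R => s * r) ^+ m.+1) * cst ((m.+1)`!%:R^-1) *
             (expR \o (fun s : R => s * r)))
     - (Re_cexp w z - horner (taylor_poly (fun i => Re (w * z ^+ i)) m.+1))); last first.
    by apply/funext => s /=; rewrite /D !fctE.
  apply: is_derive_eq.
  rewrite deriv_taylor_poly !fctE /= /GRing.scale /=.
  rewrite factS natrM; have := pnatr_eq0 R m.+1.
  have : (m`!%:R : R) != 0 by rewrite pnatr_eq0 -lt0n fact_gt0.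
  move: (m.+1%:R) (m`!%:R) => M N N0 M0; have {}M0 : M != 0 by rewrite M0.
  by rewrite exprS; field; rewrite N0 M0.
- move=> s /andP[s0 _]; rewrite /d subr_ge0.
  have := IH (w * z) (W * r) s; rewrite normrM wW zr -rmorphM => /(_ erefl s0).
  under eq_fun do rewrite -mulrA -exprS.
  move=> H; apply: (le_trans H); rewrite mulrDr -!mulrA lerDl.
  apply: mulr_ge0 => //; apply: mulr_ge0 => //; apply: mulr_ge0.
    by rewrite exprn_ge0 // mulr_ge0.
  by rewrite mulr_ge0 ?expR_ge0 // invr_ge0 ler0n.
- rewrite /D /Re_cexp !mul0r expR0 cos0 sin0 expr0n /= !mul0r mulr0 sub0r.
  rewrite horner_coef0 coef_poly /= expr0 fact0 divr1 !mulr1 mulr0 mul1r subr0.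
  by rewrite subrr oppr0.
Qed.

(** The modulus of the remainder g is attained in the direction of the
conjugate of g. *)
Lemma cexp_remainder m z (r : R) : `|z| = r%:C ->
  `|cexp z - \sum_(i < m) z ^+ i / (i`!%:R)| <= (r ^+ m / m`!%:R * expR r)%:C.
Proof.
move=> zr; set g := cexp z - _.
have [g0|g0] := eqVneq `|g| 0.
  rewrite g0 ler0c mulr_ge0 ?expR_ge0 // mulr_ge0 ?invr_ge0 //.
  by rewrite exprn_ge0 // -ler0c -zr.
have gr : `|g| = (Re `|g|)%:C by rewrite RRe_real ?normr_real.
have := @Re_cexp_remainder m (conjc g) z (Re `|g|) r 1.
rewrite normcJ => /(_ gr zr ler01); rewrite mul1r -lecR.
rewrite [X in _ <= X]rmorphM /= -gr.
rewrite Re_cexpE mul1r horner_poly.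
under eq_bigr => i _ do rewrite expr1n mulr1.
have ReB (x y : R[i]) : Re (x - y) = Re x - Re y by case: x y => [? ?] [].
have ReD (x y : R[i]) : Re (x + y) = Re x + Re y by case: x y => [? ?] [].
have Re_div (x : R[i]) n : Re (x / n%:R) = Re x / n%:R.
  rewrite -(rmorph_nat (real_complex R)) -fmorphV /= mulrC.
  by case: (x) => a b; simpc; rewrite mulrC.
have -> : Re (conjc g * cexp z) - \sum_(i < m) Re (conjc g * z ^+ i) / i`!%:R =
   Re (conjc g * g).
  rewrite /g mulrBr ReB; congr (_ - _); rewrite mulr_sumr.
  rewrite (big_morph (@Re R) ReD (erefl : Re (0 : R[i]) = 0)).
  by apply: eq_bigr => i _; rewrite mulrA Re_div.
rewrite mulrC -sqr_normc RRe_real ?expr2 ?rpredM ?normr_real //.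
by rewrite ler_pM2l // lt_def g0 normr_ge0.
Qed.

End ComplexExponential.

(** * Hermite's simultaneous approximation of the exponential *)

Section Hermite.
Local Open Scope complex_scope.
Local Notation Re := complex.Re.
Variable R : realType.
Implicit Types (x y z L : R[i]) (G : {poly R[i]}).

(** For L = 1 this is Hermite's sum of all derivatives of G, a polynomial whose
derivative differs from it by G. The powers of L rescale the variable: the
values at the points L x are integral when L clears denominators. *)
Definition hermite L G y := \sum_(i < size G) L ^+ i * G^`(i).[y].

(** For a monomial, the sum of all derivatives is a multiple of a Taylor
polynomial of the exponential; the bound N is free because the derivatives of
order above m vanish. *)
Lemma hermiteXn L x m N : (m < N)%N ->
  \sum_(i < N) L ^+ i * ('X^m : {poly R[i]})^`(i).[L * x] =
  L ^+ m * m`!%:R * \sum_(j < m.+1) x ^+ j / j`!%:R.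
Proof.
move=> mN.
have trunc (F : nat -> R[i]) : (forall i, (m < i)%N -> F i = 0) ->
    \sum_(i < N) F i = \sum_(i < m.+1) F i.
  move=> F0; rewrite -(subnKC mN) big_split_ord /= [X in _ + X]big1 ?addr0 // => i _.
  by rewrite F0 // leq_addr.
rewrite (trunc (fun i => L ^+ i * ('X^m)^`(i).[L * x])); last first.
  by move=> i mi; rewrite derivnXn ffact_small // mulr0n horner0 mulr0.
rewrite (reindex_inj rev_ord_inj) mulr_sumr; apply: eq_bigr => j _ /=.
have jm : (j <= m)%N by rewrite -ltnS.
rewrite subSS derivnXn hornerMn hornerXn subKn // exprMn -mulrnAr.
rewrite -(ffact_fact (leq_subr j m)) subKn // natrM mulrCA.
have -> : L ^+ m = L ^+ (m - j) * L ^+ j by rewrite -exprD subnK.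
rewrite -mulr_natr; field.
by rewrite pnatr_eq0 -lt0n fact_gt0.
Qed.

Lemma hermiteE L G x : hermite L G (L * x) =
  \sum_(m < size G) G`_m * (L ^+ m * m`!%:R * \sum_(j < m.+1) x ^+ j / j`!%:R).
Proof.
under [RHS]eq_bigr => m _ do rewrite -(hermiteXn _ _ (ltn_ord m)) mulr_sumr.
rewrite exchange_big; apply: eq_bigr => i _ /=.
rewrite -[X in derivn _ X]coefK poly_def linear_sum horner_sum mulr_sumr.
by apply: eq_bigr => m _; rewrite /= derivnZ hornerZ mulrCA.
Qed.

Lemma hermite0E L G : hermite L G 0 = \sum_(m < size G) G`_m * (L ^+ m * m`!%:R).
Proof.
have := hermiteE L G 0; rewrite mulr0 => ->; apply: eq_bigr => m _.
rewrite big_ord_recl big1 ?addr0 ?expr0 ?fact0 ?divr1 ?mulr1 // => i _.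
by rewrite expr0n mul0r.
Qed.

(** Monomial by monomial, the left-hand side is a Taylor remainder of the
exponential; the factorial in its denominator cancels that of [hermiteXn]. *)
Lemma hermite_remainder L G x (l r : R) : `|L| = l%:C -> `|x| <= r%:C ->
  `|hermite L G 0 * cexp x - hermite L G (L * x)| <=
  (r * expR r)%:C * \sum_(m < size G) `|G`_m| * ((l * r) ^+ m)%:C.
Proof.
move=> Ll xr; rewrite hermiteE hermite0E mulr_suml -sumrB mulr_sumr.
apply: (le_trans (ler_norm_sum _ _ _)); apply: ler_sum => m _.
rewrite -(mulrA G`_m) -mulrBr normrM mulrCA ler_wpM2l //.
rewrite -mulrBr normrM normrM normrX Ll normr_nat.
have xE : `|x| = (Re `|x|)%:C by rewrite RRe_real ?normr_real.
have x0 : 0 <= Re `|x| by rewrite -ler0c -xE.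
have xr' : Re `|x| <= r by rewrite -lecR -xE.
have l0 : 0 <= l by rewrite -ler0c -Ll.
have r0 : 0 <= r by exact: le_trans xr'.
have := cexp_remainder m.+1 xE => H.
apply: (le_trans (ler_wpM2l _ H)).
  by rewrite mulr_ge0 ?exprn_ge0 ?ler0c.
rewrite -(rmorph_nat (real_complex R)) -rmorphXn -!rmorphM lecR /=.
have fm : (m`!%:R : R) != 0 by rewrite pnatr_eq0 -lt0n fact_gt0.
have xm : Re `|x| ^+ m.+1 <= r ^+ m.+1 by apply: lerXn2r.
have -> : l ^+ m * m`!%:R * (Re `|x| ^+ m.+1 / (m.+1)`!%:R * expR (Re `|x|)) =
  l ^+ m * (Re `|x| ^+ m.+1 * expR (Re `|x|)) * m.+1%:R^-1.
  rewrite factS natrM; have : m.+1%:R != 0 :> R by [].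
  by move: (m.+1%:R) => M M0; field; rewrite fm M0.
have -> : r * expR r * (l * r) ^+ m = l ^+ m * (r ^+ m.+1 * expR r).
  by rewrite exprMn exprS; ring.
rewrite -[leRHS]mulr1; apply: ler_pM => //.
- by rewrite !mulr_ge0 ?exprn_ge0 ?expR_ge0.
- rewrite ler_wpM2l ?exprn_ge0 //.
  by apply: ler_pM; rewrite ?exprn_ge0 ?expR_ge0 ?ler_expR.
- by rewrite invf_le1 ?ler1n ?ltr0n.
Qed.
End Hermite.

(** * Weighted coefficient norms *)

Section WeightedNorm.
Variables (R : realType) (rho : R).
Hypothesis rho0 : 0 <= rho.
Implicit Types g h : {poly int}.

Definition abs_poly g : {poly R} := map_poly (fun z : int => `|z|%:~R) g.

Definition wnorm g : R := (abs_poly g).[rho].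

Lemma coef_abs_poly g i : (abs_poly g)`_i = `|g`_i|%:~R.
Proof. by rewrite coef_map_id0 // normr0. Qed.

Lemma wnorm_ge0 g : 0 <= wnorm g.
Proof.
rewrite /wnorm horner_coef; apply: sumr_ge0 => i _.
by rewrite coef_abs_poly mulr_ge0 ?exprn_ge0 // ler0z.
Qed.

Lemma wnormE g : wnorm g = \sum_(m < size g) `|g`_m|%:~R * rho ^+ m.
Proof.
rewrite /wnorm (horner_coef_wide _ (size_poly _ _)).
by apply: eq_bigr => m _; rewrite coef_abs_poly.
Qed.

(** Each coefficient of g h is bounded by the same coefficient of the product
of the polynomials of absolute values. *)
Lemma wnormM g h : wnorm (g * h) <= wnorm g * wnorm h.
Proof.
rewrite /wnorm -hornerM -subr_ge0 -hornerN -hornerD horner_coef.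
apply: sumr_ge0 => k _; apply: mulr_ge0; last exact: exprn_ge0.
rewrite coefB subr_ge0 coefM coef_abs_poly coefM.
apply: (@le_trans _ _ (\sum_(j < k.+1) `|g`_j * h`_(k - j)|)%:~R).
  by rewrite ler_int ler_norm_sum.
rewrite rmorph_sum /=; apply: ler_sum => j _.
by rewrite !coef_abs_poly normrM intrM.
Qed.

Lemma wnormXn g n : wnorm (g ^+ n) <= wnorm g ^+ n.
Proof.
elim: n => [|n IH].
  rewrite !expr0 /wnorm (_ : abs_poly 1 = 1) ?hornerE //.
  by apply/polyP => i; rewrite coef_abs_poly !coef1; case: eqP.
by rewrite !exprS; apply: (le_trans (wnormM _ _)); rewrite ler_wpM2l ?wnorm_ge0.
Qed.

End WeightedNorm.

(** * Niven's argument *)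

Lemma derivn_high_root (F : comNzRingType) (a : F) (m i : nat) (H : {poly F}) :
  (i < m)%N -> ((('X - a%:P) ^+ m * H)^`(i)).[a] = 0.
Proof.
elim: i m H => [|i IH] [|m] H //.
  by rewrite exprS -mulrA hornerM hornerXsubC subrr mul0r.
rewrite ltnS => im; rewrite derivSn derivM deriv_exp derivXsubC mul1r /=.
rewrite (_ : _ + _ = ('X - a%:P) ^+ m * (H *+ m.+1 + ('X - a%:P) * H^`())).
  exact: IH.
by rewrite exprS; ring.
Qed.

(** The terms of the exponential series tend to 0. *)
Lemma fact_gt_geometric (R : realType) (K M : R) :
  exists N : nat, forall n, (N <= n)%N -> K * M ^+ n < n`!%:R.
Proof.
have : ((cst K \* exp_coeff M : nat -> R) @ \oo --> K * 0)%classic.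
  apply: cvgM; first exact: cvg_cst.
  by apply: cvg_series_cvg_0; exact: is_cvg_series_exp_coeff.
rewrite mulr0 => /cvgr_lt /(_ 1 ltr01) [N _ HN].
by exists N => n /HN /=; rewrite /exp_coeff /= mulrA ltr_pdivrMr ?mul1r.
Qed.

Section Niven.
Local Open Scope complex_scope.
Local Notation Re := complex.Re.
Variables (R : realType) (n : nat) (theta : n.-tuple R[i]) (l : int) (Q : {poly int}).
Let y (S : {set 'I_n}) : R[i] := \sum_(i in S) (l%:~R * tnth theta i).
Hypothesis l0 : l != 0.
Hypothesis Q0 : Q.[0] != 0.
Hypothesis rootQ : forall S, y S != 0 -> root (map_poly intr Q) (y S).
Hypothesis int_coef : forall i,
  integer (\prod_(x <- [tuple l%:~R * tnth theta i | i < n]) ('X - x%:P))`_i.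

Let x (S : {set 'I_n}) : R[i] := \sum_(i in S) tnth theta i.

Let yE S : y S = l%:~R * x S.
Proof. by rewrite /x mulr_sumr. Qed.

(* The empty set is counted, so that c > 0. *)
Let c := #|[set S | y S == 0]|.

Lemma integer_sum_roots (g : {poly int}) : integer (\sum_S (map_poly intr g).[y S]).
Proof.
have := integer_subset_sums g (@intr_inj R[i]) int_coef.
by under eq_bigr => S _ do under eq_bigr => i _ do rewrite tnth_mktuple.
Qed.

(* Hermite's auxiliary polynomial; p + 1 will be a large prime. *)
Let g p : {poly int} := 'X^p * Q ^+ p.+1.

Lemma derivn_auxiliary_low p i S : (i < p)%N -> (map_poly intr (g p))^`(i).[y S] = 0.
Proof.
move=> ip; rewrite rmorphM !rmorphXn /= map_polyX.
have [->|/rootQ/factor_theorem[q ->]] := eqVneq (y S) 0.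
  by rewrite -['X]subr0 -[0]polyC0 derivn_high_root.
by rewrite exprMn mulrA mulrC derivn_high_root // ltnS ltnW.
Qed.

Lemma derivn_auxiliary_mid p S : (map_poly intr (g p))^`(p).[y S] =
  if y S == 0 then (p`! %:Z * Q.[0] ^+ p.+1)%:~R else 0.
Proof.
rewrite rmorphM !rmorphXn /= map_polyX.
have [->|/rootQ/factor_theorem[q ->]] := eqVneq (y S) 0; last first.
  by rewrite exprMn mulrA mulrC derivn_high_root.
rewrite [LHS]horner_coef0 coef_derivn addn0 ffactnn coefXnM ltnn subnn.
rewrite -horner_coef0 horner_exp !horner_coef0 coef_map.
by rewrite rmorphM rmorphXn /= mulr_natl.
Qed.

(** Derivatives of order below p vanish at all the points; the one of order p
vanishes at the nonzero points and contributes the term with c; in order i > p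
the factor i! is a multiple of (p + 1)!, and what remains is an integer by
symmetry. *)
Lemma hermite_sum_integer p : exists z : int,
  \sum_S hermite l%:~R (map_poly intr (g p)) (y S) =
  p`!%:R * ((l ^+ p * Q.[0] ^+ p.+1) *+ c + p.+1%:Z * z)%:~R.
Proof.
set G := map_poly intr (g p).
pose T i : R[i] := l%:~R ^+ i * \sum_S G^`(i).[y S].
(* Summing up to p + 1 + size G, past the degree of G, makes the splitting of
   the orders into i < p, i = p and i > p unconditional. *)
have -> : \sum_S hermite l%:~R G (y S) = \sum_(i < p + (1 + size G)) T i.
  rewrite /hermite exchange_big addnA addnC big_split_ord /=.
  rewrite [X in _ = _ + X]big1 ?addr0; last first.
    move=> i _; rewrite /T big1 ?mulr0 // => S _.
    by rewrite derivn_poly0 ?horner0 // leq_addr.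
  by apply: eq_bigr => i _; rewrite /T mulr_sumr.
rewrite big_split_ord /= big1 ?add0r; last first.
  by move=> i _; rewrite /T big1 ?mulr0 // => S _; rewrite derivn_auxiliary_low.
rewrite big_ord_recl /=.
have -> : T (p + 0)%N = p`!%:R * ((l ^+ p * Q.[0] ^+ p.+1) *+ c)%:~R.
  rewrite addn0 /T (eq_bigr _ (fun S _ => derivn_auxiliary_mid p S)) -big_mkcond /=.
  rewrite sumr_const -(@eq_card _ [set S | y S == 0]) => [|S]; last by rewrite inE.
  by rewrite rmorphMn rmorphM !rmorphXn /= mulrnAr rmorphM rmorphXn /= mulrnAr mulrCA.
pose t i : R[i] :=
  l%:~R ^+ i * (i`! %/ (p.+1)`!)%:R * \sum_S (map_poly intr (g p)^`N(i)).[y S].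
have [z zE] : integer (\sum_(j < size G) t (p + bump 0 j)%N).
  apply: integer_sum => j _; apply: integerM; last exact: integer_sum_roots.
  exists (l ^+ (p + bump 0 j) * ((p + bump 0 j)`! %/ (p.+1)`!)%:Z).
  by rewrite rmorphM rmorphXn.
exists z; rewrite rmorphD rmorphM /= mulrDr; congr (_ + _).
rewrite mulrA -natrM mulnC -factS -zE mulr_sumr; apply: eq_bigr => j _.
rewrite /T mulrCA -mulrA; congr (_ * _); rewrite mulrA -natrM.
rewrite divnK; last first.
  have -> : (p + bump 0 j = p.+1 + j)%N by rewrite /bump /=; lia.
  by rewrite -(bin_fact (leq_addr j p.+1)) mulnCA dvdn_mulr.
rewrite mulr_sumr; apply: eq_bigr => S _.
by rewrite nderivn_def nderivn_map hornerMn mulr_natl.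
Qed.

Lemma sum_cexp : \prod_(i < n) (1 + cexp (tnth theta i)) = \sum_S cexp (x S).
Proof.
under eq_bigr => i _ do rewrite addrC.
rewrite bigA_distr; apply: eq_bigr => S _.
by rewrite cexp_sum [RHS]big_mkcond.
Qed.

(** The exponentials of the subset sums add up to 0, so that the terms
hermite 0 * exp x_S cancel and only the remainders are left. *)
Lemma hermite_sum_bound p (r : R) : \prod_(i < n) (1 + cexp (tnth theta i)) = 0 ->
  (forall S, `|x S| <= r%:C) ->
  `|\sum_S hermite l%:~R (map_poly intr (g p)) (y S)| <=
  ((2 ^ n)%:R * (r * expR r) * wnorm (`|l|%:~R * r) (g p))%:C.
Proof.
rewrite sum_cexp => sum0 xr; set G := map_poly intr (g p).
have -> : \sum_S hermite l%:~R G (y S) =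
  - \sum_S (hermite l%:~R G 0 * cexp (x S) - hermite l%:~R G (y S)).
  by rewrite sumrB -mulr_sumr sum0 mulr0 sub0r opprK.
rewrite normrN (le_trans (ler_norm_sum _ _ _)) //.
have lC : `|l%:~R : R[i]| = (`|l|%:~R)%:C by rewrite rmorph_int intr_norm.
have wE : \sum_(m < size G) `|G`_m| * ((`|l|%:~R * r) ^+ m)%:C =
    (wnorm (`|l|%:~R * r) (g p))%:C.
  rewrite wnormE rmorph_sum /= size_map_inj_poly //; last exact: intr_inj.
  apply: eq_bigr => m _; rewrite rmorphM /=; congr (_ * _).
  by rewrite coef_map_id0 // rmorph_int intr_norm.
apply: (@le_trans _ _
  (\sum_(S : {set 'I_n}) ((r * expR r) * wnorm (`|l|%:~R * r) (g p))%:C)).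
  by apply: ler_sum => S _; rewrite rmorphM /= -wE yE; apply: hermite_remainder.
rewrite sumr_const -cardsT -powersetT card_powerset cardsT card_ord.
by rewrite -rmorphMn lecR -[leRHS]mulrA mulr_natl.
Qed.

(** The integer in [hermite_sum_integer] is nonzero modulo the prime p + 1 once
the latter exceeds l, Q(0) and c, so the sum is at least p! in absolute value;
[hermite_sum_bound] bounds it by a geometric sequence. *)
Theorem prod_one_plus_cexp_neq0 : \prod_(i < n) (1 + cexp (tnth theta i)) != 0.
Proof.
apply/eqP => prod0.
pose r : R := \sum_(i < n) Re `|tnth theta i|.
have rE i : `|tnth theta i| = (Re `|tnth theta i|)%:C by rewrite RRe_real ?normr_real.
have rE0 i : 0 <= Re `|tnth theta i| by rewrite -ler0c -rE.
have xr S : `|x S| <= r%:C.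
  rewrite /x (le_trans (ler_norm_sum _ _ _)) // rmorph_sum /=.
  under [leRHS]eq_bigr => i _ do rewrite -rE.
  by rewrite [leRHS](bigID (mem S)) /= lerDl sumr_ge0.
have r0 : 0 <= r by exact: sumr_ge0.
pose rho : R := `|l|%:~R * r.
have rho0 : 0 <= rho by rewrite mulr_ge0 ?ler0z.
pose K : R := (2 ^ n)%:R * (r * expR r) * wnorm rho Q.
pose M : R := wnorm rho 'X * wnorm rho Q.
have [N HN] := fact_gt_geometric K M.
pose B := (N + `|l| + `|Q.[0]| + c)%N.
have [P Pbig Pprime] := prime_above B.
case: P Pbig Pprime => // p Bp pprime.
have [z zE] := hermite_sum_integer p.
have := hermite_sum_bound p prod0 xr.
rewrite zE normrM normr_nat -intr_norm -!(rmorph_nat (real_complex R)).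
rewrite -(rmorph_int (real_complex R)) -rmorphM lecR.
set J := _ + _ => Hle.
have J0 : J != 0.
  apply/eqP => JE; have : (p.+1%:Z %| (l ^+ p * Q.[0] ^+ p.+1) *+ c)%Z.
    apply/dvdzP; exists (- z); move: JE; rewrite /J => /eqP.
    by rewrite addr_eq0 => /eqP ->; rewrite mulNr mulrC.
  have c0 : (0 < c)%N.
    by apply/card_gt0P; exists finset.set0; rewrite inE /y big_set0.
  have ndvd a : a != 0 -> (`|a| <= B)%N -> ~~ (p.+1 %| `|a|)%N.
    by move=> a0 aB; rewrite gtnNdvd ?absz_gt0 // (leq_ltn_trans aB).
  rewrite dvdzE -mulr_natr !abszM !Euclid_dvdM // !abszX => /orP[/orP[]|].
  - by rewrite Euclid_dvdX // => /andP[+ _]; apply/negP/ndvd => //; rewrite /B; lia.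
  - by rewrite Euclid_dvdX // => /andP[+ _]; apply/negP/ndvd => //; rewrite /B; lia.
  - by rewrite natz; apply/negP; rewrite gtnNdvd //; move: Bp; rewrite /B; lia.
have : p`!%:R <= K * M ^+ p.
  apply: (@le_trans _ _ (p`!%:R * `|J|%:~R)).
    by rewrite ler_peMr // -[1]/(1%:~R) ler_int -gtz0_ge1 normr_gt0.
  apply: (le_trans Hle); rewrite /K /M -/rho -!mulrA; apply: ler_wpM2l => //.
  apply: ler_wpM2l => //; apply: ler_wpM2l; first exact: expR_ge0.
  rewrite exprMn mulrCA -exprS.
  apply: (le_trans (wnormM rho0 _ _)).
  by apply: ler_pM; rewrite ?wnorm_ge0 ?wnormXn.
by rewrite leNgt HN //; lia.
Qed.
End Niven.

(** * Algebraic numbers *)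

Section AlgebraicNumbers.
Variable F : numFieldType.
Local Notation algebraic := (algebraicOver (ratr : rat -> F)).

Lemma algebraic_int_poly (z : F) : algebraic z ->
  exists2 q : {poly int}, q != 0 & root (map_poly intr q) z.
Proof.
move=> [p p0 pz]; have [q [a a0 pE]] := rat_poly_scale p.
exists q.
  by apply: contraNneq p0 => q0; rewrite pE q0 rmorph0 scaler0.
move: pz; rewrite pE map_polyZ rootE hornerZ mulf_eq0 fmorph_eq0 invr_eq0 intr_eq0.
rewrite (negPf a0) /= -map_poly_comp rootE.
by rewrite (@eq_map_poly _ _ _ intr) // => i /=; rewrite ratr_int.
Qed.

Lemma algebraic_int_poly_neq0 (z : F) : z != 0 -> algebraic z ->
  exists2 q : {poly int}, q.[0] != 0 & root (map_poly intr q) z.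
Proof.
move=> z0 /algebraic_int_poly[q q0].
have [m [p]] := multiplicity_XsubC q 0; rewrite q0 /= => p0 ->.
rewrite rmorphM rootE hornerM mulf_eq0 -rootE => /orP[pz|].
  by exists p.
by rewrite subr0 rmorphXn /= map_polyX hornerXn expf_eq0 (negPf z0) andbF.
Qed.

Lemma int_poly_algebraic (q : {poly int}) (z : F) : q != 0 ->
  root (map_poly intr q) z -> algebraic z.
Proof.
move=> q0 qz; exists (map_poly intr q).
  by rewrite map_poly_eq0_id0 // intr_eq0 lead_coef_eq0.
rewrite -map_poly_comp (@eq_map_poly _ _ _ intr) // => i /=; by rewrite ratr_int.
Qed.

Lemma algebraic_int (a : int) : algebraic a%:~R.
Proof. by rewrite -ratr_int; apply: algebraic_id. Qed.

Lemma algebraic_sum (I : Type) (r : seq I) (P : pred I) (f : I -> F) :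
  (forall i, P i -> algebraic (f i)) ->
  algebraic (\sum_(i <- r | P i) f i).
Proof.
move=> h; elim/big_ind: _ => //; first exact: algebraic0.
exact: algebraic_add.
Qed.

Lemma algebraic_exp (u : F) n : algebraic u -> algebraic (u ^+ n).
Proof.
move=> au; elim: n => [|n IH]; first by rewrite expr0; exact: algebraic1.
by rewrite exprS; exact: algebraic_mul.
Qed.

Lemma algebraic_horner (P : {poly rat}) (u : F) :
  algebraic u -> algebraic (map_poly ratr P).[u].
Proof.
move=> au; rewrite horner_coef; apply: algebraic_sum => i _.
apply: algebraic_mul; last exact: algebraic_exp.
by rewrite coef_map; exact: algebraic_id.
Qed.

Lemma algebraic_of_exp (u : F) n : (0 < n)%N -> algebraic (u ^+ n) -> algebraic u.
Proof.
move=> n0 /integral_algebraic un; apply/integral_algebraic.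
have mon : 'X^n - (u ^+ n)%:P \is monic by exact: monicXnsubC.
apply: (integral_root (monic_neq0 mon)); first by rewrite rootE !hornerE subrr.
apply/integral_poly => i; rewrite coefB coefXn coefC.
by apply: integral_sub; [exact: integral_nat | case: ifP => _ //; exact: mxpoly.integral0].
Qed.

(** Homogeneity of the elementary symmetric functions. *)
Lemma coef_prod_scaled_roots (l : F) (s : seq F) k :
  (\prod_(z <- s) ('X - (l * z)%:P))`_k * l ^+ k =
  l ^+ size s * (\prod_(z <- s) ('X - z%:P))`_k.
Proof.
elim: s k => [|z s IH] k.
  by rewrite !big_nil !coef1 expr0 mul1r; case: k => [|k] /=; rewrite ?mul0r // mul1r.
rewrite !big_cons !mulrBl !coefB !coefXM !coefCM mulrBl mulrBr /=.
rewrite -mulrA IH exprS; congr (_ - _); last by ring.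
case: k => [|k] /=; first by rewrite mul0r mulr0.
by rewrite exprS mulrCA IH mulrA.
Qed.

(** Multiplying the roots of an integer polynomial by its leading coefficient
makes them algebraic integers. *)
Lemma integer_coef_scaled_roots (q : {poly int}) (s : seq F) : q != 0 ->
  map_poly intr q = lead_coef (map_poly intr q) *: \prod_(z <- s) ('X - z%:P) ->
  forall i, integer (\prod_(z <- s) ('X - ((lead_coef q)%:~R * z)%:P))`_i.
Proof.
move=> q0; rewrite lead_coef_map_inj //; last exact: intr_inj.
set l := lead_coef q => qE i.
have l0 : l%:~R != 0 :> F by rewrite intr_eq0 lead_coef_eq0.
have [si|] := ltnP (size s) i.
  by exists 0; rewrite nth_default // size_prod_XsubC.
rewrite leq_eqVlt => /predU1P[->|si].
  exists 1; have := monic_prod_XsubC s xpredT (fun z : F => l%:~R * z).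
  by rewrite monicE lead_coefE size_prod_XsubC /= => /eqP ->.
exists (l ^+ (size s - i).-1 * q`_i).
apply: (mulIf (expf_neq0 i l0)); rewrite coef_prod_scaled_roots.
have := congr1 (fun p : {poly F} => p`_i) qE; rewrite /= coefZ coef_map /= => qi.
rewrite rmorphM /= qi rmorphXn /= mulrA mulrAC -!exprSr -exprD.
by congr (_ ^+ _ * _); lia.
Qed.

End AlgebraicNumbers.

(** * Logarithms of -1 are transcendental *)

Section Pi.
Local Open Scope complex_scope.
Variable R : realType.

Theorem cexp_eqN1_transcendental (z : R[i]) :
  cexp z = -1 -> ~ algebraicOver (ratr : rat -> R[i]) z.
Proof.
move=> ez /algebraic_int_poly[q q0 qz].
have [s sE] := closed_field_poly_normal (map_poly intr q : {poly R[i]}).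
have int_coef := integer_coef_scaled_roots q0 sE.
have qC0 : lead_coef (map_poly intr q : {poly R[i]}) != 0.
  by rewrite lead_coef_eq0 map_poly_eq0_id0 // intr_eq0 lead_coef_eq0.
have zs : z \in s.
  by move: qz; rewrite sE rootZ // root_prod_XsubC.
set l := lead_coef q in int_coef.
have l0 : l != 0 by rewrite lead_coef_eq0.
(* The subset sums are algebraic, and dividing out the powers of X from a
   polynomial vanishing at a nonzero one makes its constant term nonzero. *)
pose y (S : {set 'I_(size s)}) : R[i] := \sum_(i in S) (l%:~R * tnth (in_tuple s) i).
have [Q HQ] : exists Q : {set 'I_(size s)} -> {poly int}, forall S,
    (Q S).[0] != 0 /\ (y S != 0 -> root (map_poly intr (Q S)) (y S)).
  apply: (@fin_all_exists _ _ (fun S Q =>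
    Q.[0] != 0 /\ (y S != 0 -> root (map_poly intr Q) (y S)))) => S.
  have [yS|yS] := eqVneq (y S) 0; first by exists 1; rewrite hornerC.
  have [|Q Q0 QS] := algebraic_int_poly_neq0 yS; last by exists Q.
  apply: algebraic_sum => i _; apply: algebraic_mul; first exact: algebraic_int.
  apply: (int_poly_algebraic q0).
  by rewrite sE rootZ // root_prod_XsubC mem_tnth.
have : \prod_(i < size s) (1 + cexp (tnth (in_tuple s) i)) != 0.
  apply: (@prod_one_plus_cexp_neq0 R (size s) (in_tuple s) l (\prod_S Q S)) => //.
  - rewrite horner_prod; apply/prodf_neq0 => S _; exact: (HQ S).1.
  - move=> S yS; rewrite (bigD1 S) //= rmorphM rootM.
    by rewrite (HQ S).2.
  - move=> i; have := int_coef i; rewrite (big_tnth _ _ s) big_tuple.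
    by under [in X in _ -> X]eq_bigr => j _ do rewrite tnth_mktuple.
have /tnthP[i zi] : z \in in_tuple s by [].
by rewrite (bigD1 i) //= -zi ez subrr mul0r eqxx.
Qed.

End Pi.

(** * The Hurwitz zeta function *)

Section Hurwitz.
Local Open Scope classical_set_scope.
Variable R : realType.
Implicit Types (k n : nat) (a b x h : R).

Definition hurwitz_term k x n : R := (n%:R + x) ^- k.

Definition hurwitz_zeta k x : R := limn (series (hurwitz_term k x)).

Lemma hurwitz_term_gt0 k x n : 0 < x -> 0 < hurwitz_term k x n.
Proof. by move=> x0; rewrite invr_gt0 exprn_gt0 // ltr_wpDl. Qed.

Lemma is_cvg_hurwitz k x : (1 < k)%N -> 0 < x -> cvgn (series (hurwitz_term k x)).
Proof.
move=> k1 x0.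
have cvg2 : cvgn (series (hurwitz_term 2 x)).
  apply: nondecreasing_is_cvgn.
    apply/nondecreasing_seqP => n.
    by rewrite /series /= big_nat_recr //= lerDl ltW // hurwitz_term_gt0.
  exists (x ^- 2 + x^-1) => _ [n _ <-].
  have pos (m : nat) : 0 < m%:R + x by rewrite ltr_wpDl.
  (* Telescoping: (y + 1)^-2 <= y^-1 - (y + 1)^-1. *)
  suff H : series (hurwitz_term 2 x) n.+1 <= x ^- 2 + x^-1 - (n%:R + x)^-1.
    rewrite (le_trans (le_trans _ H)) ?gerBl ?invr_ge0 ?(ltW (pos _)) //.
    by rewrite /series /= big_nat_recr //= lerDl ltW // hurwitz_term_gt0.
  elim: n => [|n IH].
    by rewrite /series /= big_nat1 /hurwitz_term add0r addrK.
  rewrite /series /= big_nat_recr //=; apply: (le_trans (lerD IH (lexx _))).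
  rewrite -addrA lerD2l /hurwitz_term.
  have := pos n; have -> : n.+1%:R + x = n%:R + x + 1 by rewrite -natr1; ring.
  move: (n%:R + x) => y y0; rewrite -subr_ge0.
  have -> : - (y + 1)^-1 - (- y^-1 + (y + 1) ^- 2) = (y * (y + 1) ^+ 2)^-1.
    by field; rewrite !gt_eqF //; lra.
  by rewrite invr_ge0 mulr_ge0 ?exprn_ge0 ?ltW //; lra.
case: k k1 => [|[|k]] // _.
apply: (@series_le_cvg _ _ (x ^- k *: hurwitz_term 2 x)) => [n|n|n|].
- by rewrite ltW ?hurwitz_term_gt0.
- by rewrite /GRing.scale /= mulr_ge0 ?ltW ?hurwitz_term_gt0 // invr_gt0 exprn_gt0.
- have nx : 0 < n%:R + x by rewrite ltr_wpDl.
  rewrite -[X in _ <= X]/(x ^- k * (n%:R + x) ^- 2) /hurwitz_term -invfM.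
  rewrite -(addn2 k) exprD lef_pV2 ?posrE ?mulr_gt0 ?exprn_gt0 //.
  rewrite ler_wpM2r ?exprn_ge0 ?(ltW nx) //.
  by rewrite lerXn2r ?nnegrE ?(ltW nx) ?(ltW x0) // lerDr.
- exact: is_cvg_seriesZ.
Qed.

Lemma hurwitz_zeta_shift k x : (1 < k)%N -> 0 < x ->
  hurwitz_zeta k x = x ^- k + hurwitz_zeta k (x + 1).
Proof.
move=> k1 x0; have x1 : 0 < x + 1 by rewrite addr_gt0.
apply/cvg_lim => //; rewrite -(@cvg_shiftS R).
have -> : (fun n => series (hurwitz_term k x) n.+1) =
    cst (x ^- k) \+ series (hurwitz_term k (x + 1)).
  apply/funext => n; rewrite /series /= big_nat_recl //=; congr (_ + _).
    by rewrite /hurwitz_term add0r.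
  by apply: eq_bigr => i _; rewrite /hurwitz_term -natr1 addrAC addrA.
by apply: cvgD; [exact: cvg_cst | exact: is_cvg_hurwitz].
Qed.

Lemma hurwitz_zeta_gt0 k x : (1 < k)%N -> 0 < x -> 0 < hurwitz_zeta k x.
Proof.
move=> k1 x0; rewrite hurwitz_zeta_shift // ltr_pwDl ?invr_gt0 ?exprn_gt0 //.
have x1 : 0 < x + 1 by rewrite addr_gt0.
apply: limr_ge; first exact: is_cvg_hurwitz.
by near=> n; apply: sumr_ge0 => i _; rewrite ltW ?hurwitz_term_gt0.
Unshelve. all: by end_near.
Qed.

(** The mean value theorem for the function t^-k, whose derivative -k t^-(k+1)
is monotone. Summed over the translates of a and b, it gives the monotonicity,
the continuity and the derivative of the zeta function. *)
Lemma invX_diff_bounds k a b : 0 < a -> a <= b ->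
  (b - a) * (k%:R * b ^- k.+1) <= a ^- k - b ^- k <= (b - a) * (k%:R * a ^- k.+1).
Proof.
move=> a0 ab; have b0 : 0 < b := lt_le_trans a0 ab.
rewrite -!exprVn; set u := a^-1; set v := b^-1.
have v0 : 0 < v by rewrite invr_gt0.
have vu : v <= u by rewrite lef_pV2.
have u0 : 0 < u by rewrite invr_gt0.
have E1 : (b - a) * v = (u - v) * a.
  by rewrite /u /v; field; rewrite !gt_eqF.
have E2 : (b - a) * u = (u - v) * b.
  by rewrite /u /v; field; rewrite !gt_eqF.
have av : a * v <= 1 by rewrite ler_pdivrMr // mul1r.
have bu : 1 <= b * u by rewrite ler_pdivlMr // mul1r.
have vk n : 0 <= v ^+ n by rewrite exprn_ge0 ?(ltW v0).
have uvk n : v ^+ n <= u ^+ n by rewrite lerXn2r ?nnegrE ?(ltW v0) ?(ltW u0).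
have duv : 0 <= u - v by rewrite subr_ge0.
elim: k => [|k /andP[IH1 IH2]]; first by rewrite !expr0 subrr !mul0r mulr0 lexx.
apply/andP; split.
- have -> : (b - a) * (k.+1%:R * v ^+ k.+2) =
      v * ((b - a) * (k%:R * v ^+ k.+1)) + ((b - a) * v) * v ^+ k.+1.
    by rewrite -natr1 !exprS; ring.
  have -> : u ^+ k.+1 - v ^+ k.+1 = v * (u ^+ k - v ^+ k) + (u - v) * u ^+ k.
    by rewrite !exprS; ring.
  apply: lerD; first by rewrite ler_wpM2l // ltW.
  rewrite E1 -mulrA ler_wpM2l // exprS mulrA (le_trans _ (uvk k)) //.
  by rewrite ler_piMl.
- have -> : (b - a) * (k.+1%:R * u ^+ k.+2) =
      u * ((b - a) * (k%:R * u ^+ k.+1)) + ((b - a) * u) * u ^+ k.+1.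
    by rewrite -natr1 !exprS; ring.
  have -> : u ^+ k.+1 - v ^+ k.+1 = u * (u ^+ k - v ^+ k) + (u - v) * v ^+ k.
    by rewrite !exprS; ring.
  apply: lerD; first by rewrite ler_wpM2l // ltW.
  rewrite E2 -mulrA ler_wpM2l // exprS mulrA (le_trans (uvk k)) //.
  by rewrite ler_peMl // exprn_ge0 // ltW.
Qed.

Lemma hurwitz_zeta_diff_bounds k a b : (1 < k)%N -> 0 < a -> a <= b ->
  (b - a) * (k%:R * hurwitz_zeta k.+1 b) <= hurwitz_zeta k a - hurwitz_zeta k b
     <= (b - a) * (k%:R * hurwitz_zeta k.+1 a).
Proof.
move=> k1 a0 ab; have b0 : 0 < b := lt_le_trans a0 ab.
have ca := is_cvg_hurwitz k1 a0; have cb := is_cvg_hurwitz k1 b0.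
have ca' := @is_cvg_hurwitz k.+1 a (leqW k1) a0.
have cb' := @is_cvg_hurwitz k.+1 b (leqW k1) b0.
have H n := @invX_diff_bounds k (n%:R + a) (n%:R + b) (ltr_wpDl (ler0n _ n) a0)
  (lerD (lexx _) ab).
have E n : n%:R + b - (n%:R + a) = b - a by ring.
have limB := lim_seriesB ca cb; have cB := is_cvg_seriesB ca cb.
rewrite !mulrA; apply/andP; split.
- have : limn (series (((b - a) * k%:R) *: hurwitz_term k.+1 b)) <=
         limn (series (hurwitz_term k a - hurwitz_term k b)).
    apply: lim_series_le; [exact: is_cvg_seriesZ | exact: cB |] => n.
    by have /andP[+ _] := H n; rewrite E mulrA.
  by rewrite limB lim_seriesZ.
- have : limn (series (hurwitz_term k a - hurwitz_term k b)) <=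
         limn (series (((b - a) * k%:R) *: hurwitz_term k.+1 a)).
    apply: lim_series_le; [exact: cB | exact: is_cvg_seriesZ |] => n.
    by have /andP[_ +] := H n; rewrite E mulrA.
  by rewrite limB lim_seriesZ.
Qed.

Lemma hurwitz_zeta_lt k a b : (1 < k)%N -> 0 < a -> a < b ->
  hurwitz_zeta k b < hurwitz_zeta k a.
Proof.
move=> k1 a0 ab; have b0 := lt_trans a0 ab.
rewrite -subr_gt0; have /andP[+ _] := hurwitz_zeta_diff_bounds k1 a0 (ltW ab).
apply: lt_le_trans; rewrite mulr_gt0 ?subr_gt0 // mulr_gt0 ?hurwitz_zeta_gt0 //.
  by rewrite ltr0n ltnW.
exact: leqW.
Qed.

Lemma is_derive_quadratic_bound (f : R -> R) (x df C d : R) : 0 < d ->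
  (forall h, `|h| < d -> `|f (x + h) - f x - h * df| <= C * h ^+ 2) -> is_derive x 1 f df.
Proof.
move=> d0 H.
have L : h^-1 *: ((f \o shift x) (h *: (1 : R)) - f x) @[h --> 0^'] --> df.
  apply/cvgrPdist_le => e e0.
  have C1 : 0 < `|C| + 1 by rewrite ltr_wpDl.
  near=> h.
  have h0 : h != 0 by near: h; exact: nbhs_dnbhs_neq.
  have hd : `|h| < d.
    by near: h; apply: dnbhs0_lt.
  have he : `|h| < e / (`|C| + 1).
    by near: h; apply: dnbhs0_lt; rewrite divr_gt0.
  rewrite /GRing.scale /= mulr1 (addrC h x) distrC.
  have -> : h^-1 * (f (x + h) - f x) - df = h^-1 * (f (x + h) - f x - h * df).
    by field.
  rewrite normrM normfV mulrC ler_pdivrMr ?normr_gt0 //.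
  apply: (le_trans (H h hd)); rewrite -real_normK ?num_real // expr2 mulrA.
  rewrite ler_wpM2r //; apply: (@le_trans _ _ ((`|C| + 1) * `|h|)).
    by rewrite ler_wpM2r // (le_trans (ler_norm _)) // lerDl.
  by rewrite mulrC -ler_pdivlMr // ltW.
by apply: DeriveDef; [apply/cvg_ex; exists df | exact: cvg_lim L].
Unshelve. all: by end_near.
Qed.

(** The mean value bounds for zeta_k confine the error to h k times a variation
of zeta_(k+1), and the bounds for zeta_(k+1) make this variation O(h); zeta_(k+2)
is bounded on [x / 2, +oo[. *)
Lemma is_derive_hurwitz_zeta k x : (1 < k)%N -> 0 < x ->
  is_derive x 1 (hurwitz_zeta k) (- (k%:R * hurwitz_zeta k.+1 x)).
Proof.
move=> k1 x0.
set G := hurwitz_zeta k.+2 (x / 2).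
apply: (@is_derive_quadratic_bound _ _ _ (k%:R * (k.+1%:R * G)) (x / 2)).
  by rewrite divr_gt0.
move=> h /ltr_normlP[h1 h2].
have xh0 : 0 < x + h by lra.
have k2 := leqW k1; have k3 := leqW k2.
have mono m a b : (1 < m)%N -> 0 < a -> a <= b -> hurwitz_zeta m b <= hurwitz_zeta m a.
  by move=> m1 a0; rewrite le_eqVlt => /predU1P[->//|/(hurwitz_zeta_lt m1 a0)/ltW].
have k0 : 0 <= k%:R :> R by [].
have kS0 : 0 <= k.+1%:R :> R by [].
have [h0|h0] := lerP 0 h.
- have xxh : x <= x + h by lra.
  have /andP[A1 A2] := hurwitz_zeta_diff_bounds k1 x0 xxh.
  have /andP[B1 B2] := hurwitz_zeta_diff_bounds k2 x0 xxh.
  have HG : hurwitz_zeta k.+2 x <= G by apply: mono => //; lra.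
  move: A1 A2 B1 B2 HG; rewrite addrAC subrr add0r.
  move: (hurwitz_zeta k x) (hurwitz_zeta k (x + h)) (hurwitz_zeta k.+1 x)
    (hurwitz_zeta k.+1 (x + h)) (hurwitz_zeta k.+2 x) (hurwitz_zeta k.+2 (x + h)).
  move=> a b c d e f.
  move=> A1 A2 B1 B2 HG; rewrite ger0_norm; last by lra.
  apply: (@le_trans _ _ (h * k%:R * (c - d))); first by lra.
  rewrite [leRHS](_ : _ = h * k%:R * (h * (k.+1%:R * G))); last by ring.
  apply: ler_wpM2l; first exact: mulr_ge0.
  by apply: (le_trans B2); rewrite ler_wpM2l // ler_wpM2l.
- have xxh : x + h <= x by lra.
  have /andP[A1 A2] := hurwitz_zeta_diff_bounds k1 xh0 xxh.
  have /andP[B1 B2] := hurwitz_zeta_diff_bounds k2 xh0 xxh.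
  have HG : hurwitz_zeta k.+2 (x + h) <= G by apply: mono => //; lra.
  move: A1 A2 B1 B2 HG; rewrite opprD addrA subrr add0r.
  move: (hurwitz_zeta k x) (hurwitz_zeta k (x + h)) (hurwitz_zeta k.+1 x)
    (hurwitz_zeta k.+1 (x + h)) (hurwitz_zeta k.+2 x) (hurwitz_zeta k.+2 (x + h)).
  move=> a b c d e f.
  move=> A1 A2 B1 B2 HG; rewrite ger0_norm; last by lra.
  apply: (@le_trans _ _ (- h * k%:R * (d - c))); first by lra.
  rewrite [leRHS](_ : _ = - h * k%:R * (- h * (k.+1%:R * G))); last by ring.
  have h0' : 0 <= - h by lra.
  apply: ler_wpM2l; first exact: mulr_ge0.
  by apply: (le_trans B2); rewrite ler_wpM2l // ler_wpM2l.
Qed.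

(** The two series on the left run over the even and the odd indices of the one
on the right. *)
Lemma hurwitz_zeta2_duplication x : 0 < x ->
  hurwitz_zeta 2 (x / 2) + hurwitz_zeta 2 ((x + 1) / 2) = 4 * hurwitz_zeta 2 x.
Proof.
move=> x0.
have c0 := @is_cvg_hurwitz 2 x isT x0.
have c1 := @is_cvg_hurwitz 2 (x / 2) isT (divr_gt0 x0 (ltr0Sn _ 1)).
have c2 := @is_cvg_hurwitz 2 ((x + 1) / 2) isT
  (divr_gt0 (addr_gt0 x0 ltr01) (ltr0Sn _ 1)).
rewrite /hurwitz_zeta -lim_seriesD //.
have := @cvg_series_cvg_series_group R _ 2 c0 isT => H.
have {}H := cvgM (@cvg_cst _ (4 : R) _ \oo _) H.
rewrite -[RHS](cvg_lim _ (H _ _)) //.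
congr (limn _); apply/funext => n; rewrite /series /= mulr_sumr.
apply: eq_bigr => i _.
rewrite (_ : i.+1 * 2 = (i * 2).+2)%N; last by lia.
rewrite big_nat_recr ?leqW //= big_nat1 -[LHS]/(hurwitz_term 2 (x / 2) i + _).
rewrite /hurwitz_term -(natr1 (i * 2)) natrM.
have i0 : 0 <= i%:R :> R by [].
by field; rewrite !gt_eqF //; lra.
Qed.

End Hurwitz.

(** * The bilateral sums as polynomials in the cotangent *)

Section Cotangent.
Local Open Scope classical_set_scope.
Variable R : realType.
Implicit Types (k n : nat) (a b x h : R).

(** For 0 < x < 1 this is the sum of (n + x)^-k over all integers n: the index
-(n + 1) contributes (-1)^k (n + 1 - x)^-k. *)
Definition periodic_zeta k x : R :=
  hurwitz_zeta k x + (-1) ^+ k * hurwitz_zeta k (1 - x).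

Lemma sin_le_id x : 0 <= x -> sin x <= x.
Proof.
move=> x0; rewrite -subr_ge0.
apply: (@ge0_of_derive_ge0 _ (id - sin) (fun t => 1 - cos t)) => //.
by rewrite -[leRHS]/(0 - sin 0) sin0 subr0.
Qed.

Lemma mul_cos_le_sin x : 0 <= x <= pi -> x * cos x <= sin x.
Proof.
move=> /andP[x0 xpi]; rewrite -subr_ge0.
apply: (@ge0_of_derive_ge0 _ (sin - id * cos) (fun t => t * sin t)) => //.
- move=> t; apply: is_derive_eq.
  by rewrite /GRing.scale /=; ring.
- move=> t /andP[t0 tx]; rewrite mulr_ge0 // sin_ge0_pi // t0.
  exact: le_trans xpi.
- by rewrite -[leRHS]/(sin 0 - 0 * cos 0) sin0 mul0r subrr.
Qed.

(** The upper bound is 1 / sin^2 = 1 + cot^2 together with cot x <= 1 / x. *)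
Lemma inv_sin2_bounds x : 0 < x <= pi / 2 -> x ^- 2 <= sin x ^- 2 <= 1 + x ^- 2.
Proof.
move=> /andP[x0 xpi].
have p0 := pi_gt0 R.
have s0 : 0 < sin x by rewrite sin_gt0_pi // x0 /=; lra.
have c0 : 0 <= cos x by rewrite cos_ge0_pihalf //; apply/andP; split; lra.
have H1 := sin_le_id (ltW x0).
have H2 : x * cos x <= sin x by rewrite mul_cos_le_sin // ltW //=; lra.
apply/andP; split.
  by rewrite lef_pV2 ?posrE ?exprn_gt0 // lerXn2r ?nnegrE ?(ltW s0) ?(ltW x0).
rewrite -subr_ge0; have -> : 1 + x ^- 2 - sin x ^- 2 =
   (sin x ^+ 2 - x ^+ 2 * (1 - sin x ^+ 2)) / (x ^+ 2 * sin x ^+ 2).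
  by field; rewrite !gt_eqF.
rewrite divr_ge0 //; last by rewrite mulr_ge0 ?sqr_ge0.
rewrite -cos2sin2 subr_ge0 -exprMn; apply: lerXn2r => //; rewrite nnegrE.
  by rewrite mulr_ge0 // ltW.
exact: ltW.
Qed.

Definition cot_gap x : R := periodic_zeta 2 x - pi ^+ 2 / sin (pi * x) ^+ 2.

Lemma cot_gapC x : cot_gap (1 - x) = cot_gap x.
Proof.
rewrite /cot_gap /periodic_zeta -signr_odd expr0 !mul1r subKr [X in X - _]addrC.
congr (_ - _ / _ ^+ 2).
by rewrite mulrBr mulr1 sinB sinpi cospi mul0r sub0r mulN1r opprK.
Qed.

(** By symmetry it suffices to look at x <= 1 / 2, where both terms have the
same singular part x^-2 at 0. *)
Lemma cot_gap_bounded :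
  exists2 B, 0 <= B & forall x, 0 < x < 1 -> `|cot_gap x| <= B.
Proof.
exists (4 + 2 * hurwitz_zeta 2 1 + pi ^+ 2).
  have := @hurwitz_zeta_gt0 R 2 1 isT ltr01; have := sqr_ge0 (pi : R); lra.
suff H x : 0 < x <= 1 / 2 -> `|cot_gap x| <= 4 + 2 * hurwitz_zeta 2 1 + pi ^+ 2.
  move=> x /andP[x0 x1]; have [x2|x2] := lerP x (1 / 2); first by rewrite H // x0.
  by rewrite -cot_gapC H //; apply/andP; split; lra.
move=> /andP[x0 x2].
have p0 := pi_gt0 R.
have x1 : 0 < 1 - x by lra.
rewrite /cot_gap /periodic_zeta -signr_odd expr0 mul1r.
rewrite (hurwitz_zeta_shift _ x0) // (hurwitz_zeta_shift _ x1) //.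
have /andP[] : (pi * x) ^- 2 <= sin (pi * x) ^- 2 <= 1 + (pi * x) ^- 2.
  apply: inv_sin2_bounds; rewrite mulr_gt0 //=.
  by rewrite ler_pM2l //; lra.
have z (y : R) : 0 < y -> 0 < hurwitz_zeta 2 (y + 1) <= hurwitz_zeta 2 1.
  move=> y0; apply/andP; split; first by rewrite hurwitz_zeta_gt0 ?addr_gt0.
  by apply/ltW/hurwitz_zeta_lt; rewrite // ltrDr.
have z1 := z _ x0; have z2 := z _ x1.
have i1 : 0 <= (1 - x) ^- 2 <= 4.
  rewrite invr_ge0 sqr_ge0 /= invf_ple ?posrE ?exprn_gt0 //.
  rewrite expr2; nra.
move=> /(ler_wpM2l (sqr_ge0 pi)) A1 /(ler_wpM2l (sqr_ge0 pi)) A2.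
have pE : pi ^+ 2 * (pi * x) ^- 2 = x ^- 2.
  by rewrite exprMn invfM mulVKf ?expf_neq0 ?gt_eqF.
move: A1 A2; rewrite mulrDr pE mulr1 => A1 A2.
by rewrite ler_norml; apply/andP; split; lra.
Qed.

Lemma cot_gap_duplication x : 0 < x < 1 ->
  cot_gap (x / 2) + cot_gap ((x + 1) / 2) = 4 * cot_gap x.
Proof.
move=> /andP[x0 x1]; have x1' : 0 < 1 - x by lra.
rewrite /cot_gap /periodic_zeta -signr_odd expr0 !mul1r.
have -> : 1 - (x + 1) / 2 = (1 - x) / 2 by field.
have -> : 1 - x / 2 = (1 - x + 1) / 2 by field.
rewrite !mulrBr mulrDr -(hurwitz_zeta2_duplication x0) -(hurwitz_zeta2_duplication x1').
have -> : pi * ((x + 1) / 2) = pi * x / 2 + pi / 2 by field.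
rewrite sinDpihalf.
have -> : pi * x = (pi * x / 2) *+ 2 by rewrite -mulr_natr; field.
rewrite sin_mulr2n.
have -> : pi * (x / 2) = pi * x / 2 by field.
have -> : (pi * x / 2) *+ 2 / 2 = pi * x / 2 by rewrite -mulr_natr; field.
have p0 := pi_gt0 R.
have s0 : sin (pi * x / 2) != 0.
  by rewrite gt_eqF // sin_gt0_pi //; apply/andP; split; nra.
have c0 : cos (pi * x / 2) != 0.
  by rewrite gt_eqF // cos_gt0_pihalf //; apply/andP; split; nra.
have := cos2Dsin2 (pi * x / 2).
move: (sin _) (cos _) s0 c0 => s c s0 c0 cs.
have -> : 4 * (pi ^+ 2 / ((c * s) *+ 2) ^+ 2) =
    pi ^+ 2 * (c ^+ 2 + s ^+ 2) / (c * s) ^+ 2.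
  by rewrite cs -(mulr_natr (c * s)); field; rewrite s0 c0.
by field; rewrite s0 c0.
Qed.

(** Herglotz's trick: by the duplication formula, a bound B for the gap on
]0, 1[ improves to B / 2. *)
Lemma periodic_zeta2 x : 0 < x < 1 -> periodic_zeta 2 x = pi ^+ 2 / sin (pi * x) ^+ 2.
Proof.
move=> x01; apply/eqP; rewrite -subr_eq0 -/(cot_gap x).
have [B B0 HB] := cot_gap_bounded.
have {}HB n : forall x, 0 < x < 1 -> `|cot_gap x| <= B / 2 ^+ n.
  elim: n => [|n IH] {x01}x x01; first by rewrite expr0 divr1 HB.
  have /andP[x0 x1] := x01.
  have : `|4 * cot_gap x| <= B / 2 ^+ n + B / 2 ^+ n.
    rewrite -cot_gap_duplication // (le_trans (ler_normD _ _)) // lerD // IH //.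
      by apply/andP; split; lra.
    by apply/andP; split; lra.
  rewrite normrM ger0_norm // exprS => H.
  rewrite (_ : B / (2 * 2 ^+ n) = (B / 2 ^+ n) / 2).
    by lra.
  by field; rewrite expf_neq0.
have [//|g0] := eqVneq (cot_gap x) 0.
have g1 : 0 < `|cot_gap x| by rewrite normr_gt0.
pose n := (Num.truncn (B / `|cot_gap x|)).+1.
have := HB n _ x01; rewrite leNgt; case/negP.
have Bn : B / `|cot_gap x| < 2 ^+ n.
  by rewrite (lt_trans (truncnS_gt _)) // -/n -natrX ltr_nat ltn_expl.
by rewrite ltr_pdivrMr ?exprn_gt0 // mulrC -ltr_pdivrMr.
Qed.

Lemma is_derive_periodic_zeta k x : (1 < k)%N -> 0 < x < 1 ->
  is_derive x 1 (periodic_zeta k) (- (k%:R * periodic_zeta k.+1 x)).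
Proof.
move=> k1 /andP[x0 x1]; have x1' : 0 < 1 - x by lra.
have L : is_derive x 1 (fun y : R => 1 - y) (-1).
  by apply: is_derive_eq; ring.
have D1 := is_derive_hurwitz_zeta k1 x0.
have D2 := @is_derive1_comp R (hurwitz_zeta k) (fun y => 1 - y) x _ _
  (is_derive_hurwitz_zeta k1 x1') L.
rewrite (_ : periodic_zeta k = hurwitz_zeta k +
  cst ((-1) ^+ k) * (hurwitz_zeta k \o (fun y => 1 - y))); last by apply/funext.
apply: is_derive_eq.
by rewrite /periodic_zeta /GRing.scale /= exprS; ring.
Qed.

Definition cot x : R := cos x / sin x.

Lemma is_derive_cot_pi x : 0 < x < 1 ->
  is_derive x 1 (fun y => cot (pi * y)) (- (pi * (1 + cot (pi * x) ^+ 2))).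
Proof.
move=> /andP[x0 x1]; have p0 := pi_gt0 R.
have s0 : sin (pi * x) != 0.
  by rewrite gt_eqF // sin_gt0_pi //; apply/andP; split; nra.
have L : is_derive x 1 (fun y : R => pi * y) pi.
  by apply: is_derive_eq; rewrite ?/GRing.scale /=; ring.
have C := @is_derive1_comp R cos (fun y => pi * y) x _ _ (is_derive_cos _) L.
have S := @is_derive1_comp R sin (fun y => pi * y) x _ _ (is_derive_sin _) L.
rewrite (_ : (fun y => _) = (cos \o (fun y => pi * y)) *
  (fun y => ((sin \o (fun y => pi * y)) y)^-1)); last by apply/funext.
have V : is_derive x 1 (fun y => ((sin \o (fun y => pi * y)) y)^-1)
    (- (sin (pi * x)) ^- 2 * (cos (pi * x) * pi)).
  by apply: DeriveDef; [exact: derivableV | rewrite deriveV // derive_val].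
apply: is_derive_eq.
by rewrite /cot /GRing.scale /=; field.
Qed.

(** Differentiating pi^k P(cot (pi x)) gives -pi^(k+1) ((1 + X^2) P')(cot (pi x)),
to be compared with -k times the sum of exponent k + 1. *)
Lemma periodic_zeta_cot k : exists P : {poly rat}, forall x, 0 < x < 1 ->
  periodic_zeta k.+2 x = pi ^+ k.+2 * (map_poly ratr P).[cot (pi * x)].
Proof.
elim: k => [|k [P IH]].
  exists (1 + 'X^2) => x x01; rewrite periodic_zeta2 //.
  have /andP[x0 x1] := x01; have p0 := pi_gt0 R.
  have s0 : sin (pi * x) != 0.
    by rewrite gt_eqF // sin_gt0_pi //; apply/andP; split; nra.
  rewrite rmorphD rmorph1 /= map_polyXn !hornerE.
  by rewrite /cot expr_div_n cos2sin2; field.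
exists (k.+2%:R^-1 *: (P^`() * (1 + 'X^2))) => x x01.
have near_eq : {near x, periodic_zeta k.+2 =1
    (fun y => pi ^+ k.+2 * (map_poly ratr P).[cot (pi * y)])}.
  have : x \in `]0, 1[%R by rewrite in_itv.
  move=> /near_in_itvoo; apply: filterS => y; rewrite in_itv /=; exact: IH.
have D1 := @is_derive_periodic_zeta k.+2 x isT x01.
have C := is_derive_cot_pi x01.
have Q := @is_derive1_comp R (horner (map_poly ratr P)) (fun y => cot (pi * y)) x _ _
  (is_derive_poly _ _) C.
have D2 : is_derive x 1 (fun y : R => pi ^+ k.+2 * (map_poly ratr P).[cot (pi * y)])
   (pi ^+ k.+2 * ((map_poly ratr P)^`().[cot (pi * x)] * - (pi * (1 + cot (pi * x) ^+ 2)))).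
  rewrite (_ : (fun y => _) = cst (pi ^+ k.+2) *
    (horner (map_poly ratr P) \o (fun y => cot (pi * y)))); last by apply/funext.
  by apply: is_derive_eq; rewrite /GRing.scale /= mulr0 addr0.
have := @derive_val _ _ _ _ _ _ _ (near_eq_is_derive near_eq D1).
rewrite (@derive_val _ _ _ _ _ _ _ D2) => E.
have k0 : k.+2%:R != 0 :> R by [].
apply: (mulfI k0); rewrite -[LHS]opprK -E map_polyZ rmorphM rmorphD rmorph1 /=.
rewrite map_polyXn -deriv_map hornerZ hornerM hornerD hornerC hornerXn fmorphV rmorph_nat.
by rewrite [in RHS]exprS; field.
Qed.

End Cotangent.

(** * Values at rational points *)

Section TrigAlgebraic.
Local Open Scope complex_scope.
Variable R : realType.

Lemma algebraic_real_complex (x : R) :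
  algebraicOver (ratr : rat -> R) x -> algebraicOver (ratr : rat -> R[i]) x%:C.
Proof.
move=> [p p0 px]; exists p => //.
have -> : map_poly (ratr : rat -> R[i]) p = map_poly (real_complex R) (map_poly ratr p).
  rewrite -map_poly_comp; apply: eq_map_poly => a /=; by rewrite fmorph_rat.
exact: rmorph_root.
Qed.

Local Notation algebraic := (algebraicOver (ratr : rat -> R[i])).

Lemma cexpX (z : R[i]) n : cexp z ^+ n = cexp (z *+ n).
Proof.
elim: n => [|n IH]; first by rewrite expr0 mulr0n cexp0.
by rewrite exprS IH -cexpD mulrS.
Qed.

Lemma cexp_int_ipi (m : int) : cexp ((0 +i* (pi : R)) *~ (m * 2)) = 1.
Proof.
have nat_case n : cexp ((0 +i* (pi : R)) *+ (n * 2)) = 1.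
  by rewrite mulnC mulrnA -cexpX -(cexpX _ 2) cexp_ipi sqrrN !expr1n.
case: m => n; first by rewrite -PoszM -pmulrn nat_case.
rewrite NegzE mulNr -PoszM mulrNz -pmulrn.
by apply: (mulIf (oner_neq0 _)); rewrite -{1}(nat_case n.+1) -cexpD addNr cexp0 mul1r.
Qed.

Lemma algebraic_cexp_ipi (a : rat) : algebraic (cexp (0 +i* (pi * ratr a))).
Proof.
apply: (@algebraic_of_exp _ _ (`|denq a| * 2)%N).
  by rewrite muln_gt0 absz_gt0 denq_neq0.
rewrite cexpX.
have -> : (0 +i* (pi * ratr a : R)) *+ (`|denq a| * 2) = (0 +i* pi) *~ (numq a * 2).
  have imE (x : R) : 0 +i* x = 'i * x%:C by simpc.
  rewrite !imE -mulrnAr -mulrzAr -rmorphMn -rmorphMz; congr ('i * _%:C).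
  rewrite -mulr_natr -mulrzr natrM rmorphM /= -mulrA; congr (_ * _).
  rewrite mulrA; congr (_ * _); rewrite -[`|denq a|%:R]/((Posz `|denq a|)%:~R) absz_denq.
  by rewrite /ratr divfK // intr_eq0 denq_neq0.
by rewrite cexp_int_ipi; exact: algebraic1.
Qed.

Lemma algebraic_i : algebraic 'i.
Proof.
apply: (@algebraic_of_exp _ _ 2) => //; rewrite sqr_i.
by apply: algebraic_opp; exact: algebraic1.
Qed.

Lemma algebraic_cot_pi (a : rat) : algebraic (cot (pi * ratr a : R))%:C.
Proof.
set t := pi * ratr a.
have E1 : cexp (0 +i* t) = cos t +i* sin t by rewrite /cexp /= expR0 !mul1r.
have E2 : cexp (0 +i* (- t)) = cos t -i* sin t by rewrite /cexp /= expR0 !mul1r cosN sinN.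
have A1 := algebraic_cexp_ipi a; rewrite -/t E1 in A1.
have A2 := algebraic_cexp_ipi (- a); rewrite rmorphN mulrN -/t E2 in A2.
have two : algebraic 2%:R.
  by rewrite -(rmorph_nat (ratr : {rmorphism rat -> R[i]})); exact: algebraic_id.
rewrite /cot rmorphM fmorphV /=; apply: algebraic_div.
  have -> : (cos t)%:C = (cos t +i* sin t + (cos t -i* sin t)) / 2%:R.
    apply: (mulIf (_ : 2%:R != 0)); first by rewrite pnatr_eq0.
    by rewrite divfK ?pnatr_eq0 // mulr_natr mulr2n; simpc.
  by apply: algebraic_div => //; exact: algebraic_add.
have -> : (sin t)%:C = (cos t +i* sin t - (cos t -i* sin t)) / (2%:R * 'i).
  have i0 : 'i != 0 :> R[i] by rewrite eq_complex /= oner_eq0 andbF.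
  have n0 : 2%:R * 'i != 0 :> R[i] by rewrite mulf_neq0 // pnatr_eq0.
  apply: (mulIf n0); rewrite divfK // mulrA mulr_natr mulr2n.
  by apply/eqP; rewrite eq_complex /=; apply/andP; split; apply/eqP; ring.
apply: algebraic_div; first exact: algebraic_sub.
by apply: algebraic_mul => //; exact: algebraic_i.
Qed.

Lemma pi_transcendental : ~ algebraic (pi : R)%:C.
Proof.
move=> api; apply: (@cexp_eqN1_transcendental R (0 +i* pi) (@cexp_ipi R)).
have -> : 0 +i* (pi : R) = pi%:C * 'i by simpc.
by apply: algebraic_mul => //; exact: algebraic_i.
Qed.

(** The value is pi^k times a number that is algebraic and, with the value,
nonzero. *)
Lemma periodic_zeta_transcendental k (a : rat) : (1 < k)%N -> 0 < (ratr a : R) < 1 ->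
  periodic_zeta k (ratr a : R) != 0 -> transcendental (periodic_zeta k (ratr a : R)).
Proof.
case: k => [|[|k]] // _ a01 nz alg.
have [P PE] := periodic_zeta_cot R k.
apply: pi_transcendental; apply: (@algebraic_of_exp _ _ k.+2) => //.
move: nz alg; rewrite PE // mulf_eq0 => /norP[_ nz] /algebraic_real_complex alg.
have -> : (pi : R)%:C ^+ k.+2 =
  (pi ^+ k.+2 * (map_poly ratr P).[cot (pi * ratr a)])%:C /
  ((map_poly ratr P).[cot (pi * ratr a)])%:C.
  by rewrite rmorphM /= mulfK ?rmorphXn // fmorph_eq0.
apply: algebraic_div => //.
have -> : ((map_poly ratr P).[cot (pi * ratr a : R)])%:C =
   (map_poly (ratr : rat -> R[i]) P).[(cot (pi * ratr a : R))%:C].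
  rewrite -horner_map -map_poly_comp; congr (_.[_]).
  by apply: eq_map_poly => b /=; rewrite fmorph_rat.
by apply: algebraic_horner; exact: algebraic_cot_pi.
Qed.

End TrigAlgebraic.

(** * Bilateral series *)

Section BilateralSeries.
Local Open Scope classical_set_scope.
Variable R : realType.
Implicit Types (f : int -> R) (l : R) (k : nat) (x : R).

Definition bilateral_cvg f l := exists l1 l2,
  [/\ series (fun n : nat => f n%:Z) @ \oo --> l1,
      series (fun n : nat => f (- (n.+1)%:Z)) @ \oo --> l2 & l = l1 + l2].

Lemma bilateral_cvg_sum f l : bilateral_cvg f l -> bilateral_sum f = l.
Proof.
by move=> [l1 [l2 [c1 c2 ->]]]; rewrite /bilateral_sum (cvg_lim _ c1) // (cvg_lim _ c2).
Qed.

(** The translation moves the single term f 0 from one half to the other. *)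
Lemma bilateral_cvg_succ f l : bilateral_cvg f l <-> bilateral_cvg (fun n => f (n + 1)) l.
Proof.
have E1 (n : nat) : series (fun n : nat => f n%:Z) n.+1 =
    f 0 + series (fun n : nat => f (n%:Z + 1)) n.
  rewrite /series /= big_nat_recl //=; congr (_ + _).
  by apply: eq_bigr => i _; congr f; lia.
have E2 (n : nat) : series (fun n : nat => f (- (n.+1)%:Z + 1)) n.+1 =
    f 0 + series (fun n : nat => f (- (n.+1)%:Z)) n.
  rewrite /series /= big_nat_recl //=; congr (_ + _).
  by apply: eq_bigr => i _; congr f; lia.
split=> -[l1 [l2 [c1 c2 ->]]].
  exists (l1 - f 0), (f 0 + l2); split; last by ring.
    have -> : series (fun n : nat => f (n%:Z + 1)) =
        (fun n => series (fun n : nat => f n%:Z) n.+1) - cst (f 0).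
      by apply/funext => n; rewrite !fctE E1 addrAC subrr add0r.
    by apply: cvgB; [rewrite cvg_shiftS | exact: cvg_cst].
  rewrite -cvg_shiftS; under eq_fun do rewrite E2.
  by apply: cvgD; [exact: cvg_cst | exact: c2].
exists (f 0 + l1), (l2 - f 0); split; last by ring.
  rewrite -cvg_shiftS; under eq_fun do rewrite E1.
  by apply: cvgD; [exact: cvg_cst | exact: c1].
have -> : series (fun n : nat => f (- (n.+1)%:Z)) =
    (fun n => series (fun n : nat => f (- (n.+1)%:Z + 1)) n.+1) - cst (f 0).
  by apply/funext => n; rewrite !fctE E2 addrAC subrr add0r.
by apply: cvgB; [rewrite cvg_shiftS | exact: cvg_cst].
Qed.

Lemma bilateral_cvg_shift f l (m : int) :
  bilateral_cvg f l -> bilateral_cvg (fun n => f (n + m)) l.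
Proof.
move=> fl; elim/int_ind: m => [|m IH|m IH].
- by under eq_fun do rewrite addr0.
- move/bilateral_cvg_succ: IH; congr bilateral_cvg; apply/funext => n; congr f; lia.
- apply/bilateral_cvg_succ; move: IH; congr bilateral_cvg; apply/funext => n; congr f; lia.
Qed.

Lemma series_esum_lt_pinfty (u : nat -> R) (l : R) : (forall n, 0 <= u n) ->
  series u @ \oo --> l -> (\esum_(n in [set: nat]) (u n)%:E < +oo)%E.
Proof.
move=> u0 ul; rewrite -nneseries_esumT; last by move=> n; rewrite lee_fin.
have -> : (\sum_(n <oo) (u n)%:E = l%:E)%E; last exact: ltry.
apply/cvg_lim => //; under eq_fun do rewrite sumEFin.
by apply: cvg_EFin; [near=> n | exact: ul].
Unshelve. all: by end_near.
Qed.

Lemma bilateral_cvg_summable f l : bilateral_cvg (fun n => `|f n|) l ->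
  absolutely_convergent f.
Proof.
move=> [l1 [l2 [c1 c2 _]]].
rewrite /absolutely_convergent /summable.
have half (e : nat -> int) (A : set int) : set_bij setT A e ->
    series (fun n => `|f (e n)|) @ \oo --> limn (series (fun n => `|f (e n)|)) ->
    (\esum_(n in A) `|(f n)%:E| < +oo)%E.
  move=> bij ce; rewrite (@reindex_esum _ _ _ _ _ _ _ bij).
  exact: series_esum_lt_pinfty ce.
rewrite (esumID (range Posz)) //.
rewrite lte_add_pinfty // setTI.
  apply: (half Posz); last exact: cvgP c1.
  split => [n _|n m _ _ []//|n [m _ <-]]; [by exists n | by exists m].
apply: (half (fun n => - (n.+1)%:Z)); last exact: cvgP c2.
split => [n _|n m _ _|n].
- by case=> m _; lia.
- by lia.
- move=> nP; exists (`|n|.-1)%N => //; case: n nP => n nP; last by lia.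
  by case: nP; exists n.
Qed.

Lemma bilateral_cvg_term (a : rat) k : (1 < k)%N -> 0 < (ratr a : R) < 1 ->
  bilateral_cvg (bilateral_term R a k) (periodic_zeta k (ratr a)).
Proof.
move=> k1 /andP[a0 a1]; set x : R := ratr a.
have x1 : 0 < 1 - x by rewrite subr_gt0.
exists (hurwitz_zeta k x), ((-1) ^+ k * hurwitz_zeta k (1 - x)); split=> //.
  rewrite (_ : (fun _ => _) = hurwitz_term k x); first exact: is_cvg_hurwitz.
  by apply/funext => n; rewrite /bilateral_term /hurwitz_term div1r.
rewrite (_ : (fun _ => _) = (-1) ^+ k *: hurwitz_term k (1 - x)).
  by rewrite seriesZ; apply: cvgZl_tmp; exact: is_cvg_hurwitz.
apply/funext => n; rewrite /bilateral_term -/x.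
rewrite -[RHS]/((-1) ^+ k * (n%:R + (1 - x)) ^- k) div1r.
rewrite -[in RHS]invr_sign -invfM -exprMn; congr (_ ^+ _)^-1.
by rewrite mulrNz -pmulrn -natr1; ring.
Qed.

Lemma bilateral_cvg_norm_term (a : rat) k : (1 < k)%N -> 0 < (ratr a : R) < 1 ->
  bilateral_cvg (fun n => `|bilateral_term R a k n|)
    (hurwitz_zeta k (ratr a) + hurwitz_zeta k (1 - ratr a)).
Proof.
move=> k1 /andP[a0 a1]; set x : R := ratr a.
have x1 : 0 < 1 - x by rewrite subr_gt0.
exists (hurwitz_zeta k x), (hurwitz_zeta k (1 - x)); split=> //.
  rewrite (_ : (fun _ => _) = hurwitz_term k x); first exact: is_cvg_hurwitz.
  apply/funext => n; rewrite /bilateral_term -/x div1r normfV normrX ger0_norm //.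
  by rewrite addr_ge0 // ltW.
rewrite (_ : (fun _ => _) = hurwitz_term k (1 - x)); first exact: is_cvg_hurwitz.
apply/funext => n; rewrite /bilateral_term -/x div1r normfV normrX -normrN.
have -> : - ((- n.+1%:Z)%:~R + x) = n%:R + (1 - x) by rewrite mulrNz -pmulrn -natr1; ring.
by rewrite ger0_norm // addr_ge0 // ltW.
Qed.

End BilateralSeries.

(** * Zeros of the bilateral sums *)

(** A sum of positive terms for even k; for odd k, a difference of two values of
a strictly decreasing function. *)
Lemma periodic_zeta_eq0 (R : realType) k (x : R) : (1 < k)%N -> 0 < x < 1 ->
  (periodic_zeta k x == 0) = odd k && (x == 1 / 2).
Proof.
move=> k1 /andP[x0 x1]; have x1' : 0 < 1 - x by rewrite subr_gt0.
rewrite /periodic_zeta -signr_odd; case: (odd k) => /=; last first.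
  by rewrite expr0 mul1r gt_eqF // addr_gt0 ?hurwitz_zeta_gt0.
rewrite expr1 mulN1r subr_eq0.
have -> : (x == 1 / 2) = (x == 1 - x) by apply/eqP/eqP; lra.
apply/eqP/eqP => [E|<-//].
case: (ltgtP x (1 - x)) => // lt.
  by have := hurwitz_zeta_lt k1 x0 lt; rewrite E ltxx.
by have := hurwitz_zeta_lt k1 x1' lt; rewrite E ltxx.
Qed.

Theorem corollary2 (R : realType) (alpha : rat) (k : nat)
    (halpha : alpha \isn't a Num.int) (hk : (1 < k)%N) :
  absolutely_convergent (bilateral_term R alpha k) /\
  (bilateral_sum (bilateral_term R alpha k) = 0 \/
   transcendental (bilateral_sum (bilateral_term R alpha k))) /\
  (bilateral_sum (bilateral_term R alpha k) = 0 <->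
   odd k /\ half_integer alpha).
Proof.
pose m := Num.floor alpha; pose a := alpha - m%:~R.
have a0 : 0 < a.
  rewrite subr_gt0 lt_neqAle ge_floor andbT.
  by apply: contraNneq halpha => <-; exact: intr_int.
have a1 : a < 1.
  by rewrite ltrBlDl -[1]/(1%:~R) -intrD floorD1_gt.
have x01 : 0 < (ratr a : R) < 1 by rewrite ltr0q a0 -[1](rmorph1 ratr) ltr_rat.
have shift n : bilateral_term R alpha k n = bilateral_term R a k (n + m).
  rewrite /bilateral_term /a rmorphB /= ratr_int intrD; congr (1 / _ ^+ _); ring.
have -> : bilateral_sum (bilateral_term R alpha k) = periodic_zeta k (ratr a).
  apply: bilateral_cvg_sum; have := bilateral_cvg_shift m (bilateral_cvg_term hk x01).
  by congr bilateral_cvg; apply/funext => n; rewrite shift.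
split.
  have := bilateral_cvg_shift m (bilateral_cvg_norm_term hk x01) => H.
  apply: bilateral_cvg_summable; move: H.
  by congr bilateral_cvg; apply/funext => n; rewrite shift.
split.
  have [->|nz] := eqVneq (periodic_zeta k (ratr a : R)) 0; first by left.
  by right; exact: periodic_zeta_transcendental.
have a_half : ((ratr a : R) == 1 / 2) = (a == 1 / 2).
  rewrite -(inj_eq (fmorph_inj (ratr : {rmorphism rat -> R}))).
  by rewrite fmorph_div rmorph1 rmorph_nat.
split=> [/eqP|[oddk [m' mE]]].
  rewrite periodic_zeta_eq0 // a_half => /andP[-> /eqP ahalf]; split => //.
  by exists m; rewrite -ahalf /a addrC subrK.
apply/eqP; rewrite periodic_zeta_eq0 // oddk a_half /=; apply/eqP.
have aE : a = (m' - m)%:~R + 1 / 2 by rewrite /a mE intrB; ring.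
have lo : (-1)%:~R < (m' - m)%:~R :> rat by rewrite aE in a0; rewrite mulrN1z; lra.
have hi : (m' - m)%:~R < 1%:~R :> rat by rewrite aE in a1; lra.
rewrite !ltr_int in lo hi.
by rewrite aE (_ : m' - m = 0) ?add0r //; lia.
Qed.
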